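(* Let $P,Q,R,S$ be collinear points, let $K$ be a circle, and let $\mathbf Z=\mathbf{SRQP}$ be the composition of the corresponding reversions $\mathbf P,\mathbf Q,\mathbf R,\mathbf S:K\to K$ of $K$ through $P,Q,R,S$ (with $\mathbf P$ applied first). If there exists $X\in K$ such that $\mathbf Z(X)=X$, then $\mathbf Z(X)=X$ for all $X\in K$.
   Context: Given a circle $K$ in the plane and a point $P\notin K$, the reversion through $P$ is the map $\mathbf P:K\to K$, $A\mapsto\mathbf P(A)$, such that the points $A,P,\mathbf P(A)$ are collinear and $\mathbf P(A)\neq A$. If $P\in K$, then $\mathbf P(A)=P$ for every $A\in K$.
   Formalization: The fixed point X is required not to lie on the line through P, Q, R, S (without this the claim is false, e.g. unit circle, P=Q=R=(0,0), S=(1/2,0), X=(1,0)); where AP is tangent to K at A, the reversion is taken to fix A. *)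

(* Defs.v *)
From mathcomp Require Import all_boot all_order all_algebra.
From mathcomp Require Import boolp classical_sets reals.
From mathcomp Require Import ring lra.

Set Implicit Arguments.
Unset Strict Implicit.
Unset Printing Implicit Defensive.

Import Order.TTheory GRing.Theory Num.Theory.
Local Open Scope classical_set_scope.
Local Open Scope ring_scope.

Definition plane (F : realType) : choiceType := (F * F)%type.

(* The normed structure of [F * F] carries the sup norm, so the Euclidean
   distance is written out in coordinates. *)
Definition circle (F : realType) (O : plane F) (r : F) : set (plane F) :=
  [set X | (X.1 - O.1) ^+ 2 + (X.2 - O.2) ^+ 2 = r ^+ 2].

Definition is_circle (F : realType) (K : set (plane F)) : Prop :=
  exists (O : plane F) (r : F), 0 < r /\ K = circle O r.

Definition is_line (F : realType) (L : set (plane F)) : Prop :=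
  exists a b c : F, ((a != 0) || (b != 0)) /\
    L = [set X : plane F | a * X.1 + b * X.2 = c].

Definition collinear (F : realType) (A : set (plane F)) : Prop :=
  exists L : set (plane F), is_line L /\ A `<=` L.

(* When P is outside K and the line AP is tangent to K at A, there is no second
   intersection point and [xget] returns its default value A: the points of
   tangency are fixed by the reversion. *)
Definition reversion (F : realType) (K : set (plane F)) (P A : plane F) :
    plane F :=
  if P \in K then P
  else xget A [set B | K B /\ collinear [set A; P; B] /\ B <> A].

Lemma reversion_in (F : realType) (K : set (plane F)) (P A : plane F) :
  K A -> K (reversion K P A).
Proof.
rewrite /reversion => KA; case: ifPn => [/set_mem //|_].
by case: xgetP => [B _ []|].
Qed.

Lemma second_intersection_uniq (F : realType) (K : set (plane F))
    (P A B C : plane F) :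
  is_circle K -> ~ K P -> K A ->
  K B -> collinear [set A; P; B] -> B <> A ->
  K C -> collinear [set A; P; C] -> C <> A -> B = C.
Proof.
move=> [[o1 o2] [r [r0 ->]]].
case: P A B C => [p1 p2] [a1 a2] [b1 b2] [c1 c2].
rewrite /circle /= => KP KA KB.
have aff (X : plane F) : collinear [set ((a1, a2) : plane F); (p1, p2); X] ->
    (p1 - a1) * (X.2 - a2) = (p2 - a2) * (X.1 - a1).
  move=> [L [[a [b [c [ab ->]]]] sub]].
  have := sub (a1, a2) (or_introl (or_introl erefl)).
  have := sub (p1, p2) (or_introl (or_intror erefl)).
  have := sub X (or_intror erefl) => /= h1 h2 h3.
  have e1 : a * (X.1 - a1) = - b * (X.2 - a2) by lra.
  have e2 : a * (p1 - a1) = - b * (p2 - a2) by lra.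
  case/orP: ab => n0; apply: (mulfI n0).
    by rewrite mulrA e2 mulrCA e1; ring.
  have e3 : b * (X.2 - a2) = - a * (X.1 - a1) by lra.
  have e4 : b * (p2 - a2) = - a * (p1 - a1) by lra.
  by rewrite mulrCA e3 [RHS]mulrA e4; ring.
move=> /aff /= lB nB KC /aff /= lC nC.
have d0 : (p1 - a1 != 0) || (p2 - a2 != 0).
  rewrite -negb_and; apply/negP => /andP[/eqP h1 /eqP h2]; apply: KP.
  by rewrite (subr0_eq h1) (subr0_eq h2).
have par (x y : F) : (p1 - a1) * (y - a2) = (p2 - a2) * (x - a1) ->
    exists t, x = a1 + t * (p1 - a1) /\ y = a2 + t * (p2 - a2).
  move=> h; case/orP: d0 => n0.
    exists ((x - a1) / (p1 - a1)); split; first by field.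
    by apply: (mulfI n0); apply: (addIr (- ((p1 - a1) * a2)));
      rewrite -mulrBr h; field.
  exists ((y - a2) / (p2 - a2)); split; last by field.
  by apply: (mulfI n0); apply: (addIr (- ((p2 - a2) * a1)));
    rewrite -mulrBr -h; field.
have [t [eb1 eb2]] := par _ _ lB; have [s [ec1 ec2]] := par _ _ lC.
have t0 : t != 0.
  by apply/eqP => t0; apply: nB; rewrite eb1 eb2 t0 !mul0r !addr0.
have s0 : s != 0.
  by apply/eqP => s0; apply: nC; rewrite ec1 ec2 s0 !mul0r !addr0.
have N0 : (p1 - a1) ^+ 2 + (p2 - a2) ^+ 2 != 0.
  by rewrite paddr_eq0 ?sqr_ge0 // !sqrf_eq0 negb_and.
suff est : s = t by rewrite eb1 eb2 ec1 ec2 est.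
have root (u : F) : u != 0 ->
    (a1 + u * (p1 - a1) - o1) ^+ 2 + (a2 + u * (p2 - a2) - o2) ^+ 2 = r ^+ 2 ->
    u * ((p1 - a1) ^+ 2 + (p2 - a2) ^+ 2) =
    - 2 * ((a1 - o1) * (p1 - a1) + (a2 - o2) * (p2 - a2)).
  move=> u0; rewrite -KA => h; apply: (mulfI u0); apply/eqP; rewrite -subr_eq0.
  move/eqP: h; rewrite -subr_eq0 => /eqP h; apply/eqP; rewrite -[RHS]h; ring.
apply: (mulIf N0); rewrite (root s) // -?ec1 -?ec2 //.
by rewrite (root t) // -?eb1 -?eb2.
Qed.

Lemma reversionE (F : realType) (K : set (plane F)) (P A B : plane F) :
  is_circle K -> ~ K P -> K A ->
  K B -> collinear [set A; P; B] -> B <> A -> reversion K P A = B.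
Proof.
move=> cK KP KA KB lB nB; rewrite /reversion memNset //.
case: xgetP => [C _ [KC [lC nC]]|/(_ B)]; last by case.
exact: (second_intersection_uniq cK KP KA KC lC nC KB lB nB).
Qed.

(* A fixed point on the line through P, Q, R, S does not suffice, even with all
   four centers outside K: reversions through points of a line meeting K at U
   and V exchange U and V, so U and V are always fixed by the composition. *)
Lemma fixed_point_on_line_insufficient (F : realType) :
  exists (K L : set (plane F)) (P Q R S : plane F),
    [/\ is_circle K, is_line L, [/\ L P, L Q, L R & L S],
        [/\ ~ K P, ~ K Q, ~ K R & ~ K S] &
        let Z :=
          reversion K S \o reversion K R \o reversion K Q \o reversion K P in
        (exists X, K X /\ Z X = X) /\ (exists Y, K Y /\ Z Y <> Y)].
Proof.
pose K : set (plane F) := circle (0, 0) 1.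
pose O : plane F := (0, 0); pose S : plane F := (2^-1, 0).
have cK : is_circle K by exists (0, 0), 1; split=> //; exact: ltr01.
have KO : ~ K O by rewrite /K /circle /=; nra.
have KS : ~ K S by rewrite /K /circle /=; nra.
have col (a b c : F) (X Y Z : plane F) : (a != 0) || (b != 0) ->
    a * X.1 + b * X.2 = c -> a * Y.1 + b * Y.2 = c -> a * Z.1 + b * Z.2 = c ->
    collinear [set X; Y; Z].
  move=> ab hX hY hZ; exists [set W | a * W.1 + b * W.2 = c].
  by split; [exists a, b, c | move=> W [[->|->]|->]].
have n1 : (1 : F) != 0 := oner_neq0 F.
have n01 : ((0 : F) != 0) || ((1 : F) != 0) by rewrite n1 orbT.
have n10 : ((1 : F) != 0) || ((0 : F) != 0) by rewrite n1.
have RO (x y : F) : K (x, y) -> reversion K O (x, y) = (- x, - y).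
  move=> Kxy; apply: reversionE => //.
  - by move: Kxy; rewrite /K /circle /= => <-; ring.
  - apply: (col y (- x) 0) => /=; [|ring|ring|ring].
    rewrite oppr_eq0; apply/negPn; rewrite negb_or !negbK.
    apply/negP => /andP[/eqP y0 /eqP x0].
    by move: Kxy; rewrite /K /circle /= x0 y0; lra.
  - case=> ex ey; have x0 : x = 0 by lra.
    have y0 : y = 0 by lra.
    by move: Kxy; rewrite /K /circle /= x0 y0; lra.
have KN (x y : F) : K (x, y) -> K (- x, - y).
  by rewrite /K /circle /= => <-; ring.
have O3 (x y : F) : K (x, y) ->
    reversion K O (reversion K O (reversion K O (x, y))) = (- x, - y).
  by move=> k; rewrite RO // RO ?RO ?opprK //; exact: KN.
have K1 : K (1, 0) by rewrite /K /circle /=; ring.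
have K2 : K (0, 1) by rewrite /K /circle /=; ring.
exists K, [set X | 0 * X.1 + 1 * X.2 = 0], O, O, O, S; split=> //.
- by exists 0, 1, 0.
- by split; rewrite /=; ring.
split.
- exists (1, 0); split=> //; rewrite /= O3 //; apply: reversionE => //.
  + exact: KN.
  + by apply: (col 0 1 0) => //=; ring.
  + by case; lra.
- exists (0, 1); split=> //; rewrite /= O3 //.
  rewrite (_ : reversion _ _ _ = (4 / 5, 3 / 5)); first by case; lra.
  apply: reversionE => //.
  + exact: KN.
  + by rewrite /K /circle /=; field.
  + by apply: (col 2 (- 1) 1) => /=; rewrite ?pnatr_eq0 //; field.
  + by case; lra.
Qed.

(* Main.v *)
Require Import Defs.
From mathcomp Require Import all_boot all_order all_algebra.
From mathcomp Require Import boolp classical_sets reals.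
From mathcomp Require Import ring lra.

(** In homogeneous coordinates the reversion through [P] is the reflection in
    [P] of the quadratic space defined by the circle, and all the reflections
    with center on [L] preserve the linear form vanishing on [L].  Dividing by
    this form, they become affine on the complement of [L], and in two suitable
    coordinates [(w, E)] even linear reflections preserving [m w^2 + E^2].  On
    the circle this form is the positive constant [k], so an even product, being
    a rotation, is trivial as soon as it fixes one point of the circle off [L].
    The points of the circle on [L] are exchanged by every factor. *)

Set Implicit Arguments.
Unset Strict Implicit.
Unset Printing Implicit Defensive.

Import Order.TTheory GRing.Theory Num.Theory.
Local Open Scope classical_set_scope.
Local Open Scope ring_scope.

(** * Chords through a center and the explicit reversion *)

Definition sqdist (F : realType) (A P : plane F) : F :=
  (P.1 - A.1) ^+ 2 + (P.2 - A.2) ^+ 2.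

Lemma sqdist_neq0 (F : realType) (A P : plane F) : A <> P -> sqdist A P != 0.
Proof.
case: A P => [a1 a2] [p1 p2] AP; rewrite /sqdist /=.
rewrite paddr_eq0 ?sqr_ge0 // !sqrf_eq0 !subr_eq0.
by apply/negP => /andP[/eqP e1 /eqP e2]; apply: AP; rewrite e1 e2.
Qed.

Lemma collinear_param (F : realType) (A P B : plane F) :
  A <> P -> collinear [set A; P; B] ->
  exists s, B = (A.1 + s * (P.1 - A.1), A.2 + s * (P.2 - A.2)) :> plane F.
Proof.
move=> AP [M [[a [b [c [ab ->]]]] sub]]; have N0 := sqdist_neq0 AP.
have hA := sub A (or_introl (or_introl erefl)).
have hP := sub P (or_introl (or_intror erefl)).
have hB := sub B (or_intror erefl).
move: AP N0 hA hP hB {sub}; case: A P B => [a1 a2] [p1 p2] [b1 b2].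
rewrite /sqdist /= => AP N0 hA hP hB.
have det : (p1 - a1) * (b2 - a2) = (p2 - a2) * (b1 - a1).
  case/orP: ab => n0; apply: (mulfI n0).
  - have -> : a * ((p1 - a1) * (b2 - a2)) =
      (a * p1 - a * a1) * (b2 - a2) by ring.
    have -> : a * ((p2 - a2) * (b1 - a1)) =
      (a * b1 - a * a1) * (p2 - a2) by ring.
    have -> : a * p1 - a * a1 = - (b * (p2 - a2)) by lra.
    have -> : a * b1 - a * a1 = - (b * (b2 - a2)) by lra.
    ring.
  - have -> : b * ((p1 - a1) * (b2 - a2)) =
      (b * b2 - b * a2) * (p1 - a1) by ring.
    have -> : b * ((p2 - a2) * (b1 - a1)) =
      (b * p2 - b * a2) * (b1 - a1) by ring.
    have -> : b * p2 - b * a2 = - (a * (p1 - a1)) by lra.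
    have -> : b * b2 - b * a2 = - (a * (b1 - a1)) by lra.
    ring.
(* Orthogonal projection of B - A onto P - A, a ratio valid for every direction of the line. *)
exists (((b1 - a1) * (p1 - a1) + (b2 - a2) * (p2 - a2)) /
        ((p1 - a1) ^+ 2 + (p2 - a2) ^+ 2)).
congr pair; apply: (mulIf N0).
- rewrite mulrDl mulrAC mulfVK //.
  have -> : ((b1 - a1) * (p1 - a1) + (b2 - a2) * (p2 - a2)) * (p1 - a1) =
    (b1 - a1) * (p1 - a1) ^+ 2 + (p2 - a2) * ((p1 - a1) * (b2 - a2)) by ring.
  by rewrite det; ring.
- rewrite mulrDl mulrAC mulfVK //.
  have -> : ((b1 - a1) * (p1 - a1) + (b2 - a2) * (p2 - a2)) * (p2 - a2) =
    (p1 - a1) * ((p2 - a2) * (b1 - a1)) + (b2 - a2) * (p2 - a2) ^+ 2 by ring.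
  by rewrite -det; ring.
Qed.

Lemma collinear_of_param (F : realType) (A P : plane F) (s : F) : A <> P ->
  collinear [set A; P; (A.1 + s * (P.1 - A.1), A.2 + s * (P.2 - A.2))].
Proof.
move=> AP; exists [set X : plane F | (P.2 - A.2) * X.1 + (A.1 - P.1) * X.2 =
  (P.2 - A.2) * A.1 + (A.1 - P.1) * A.2]; split.
  exists (P.2 - A.2), (A.1 - P.1), ((P.2 - A.2) * A.1 + (A.1 - P.1) * A.2).
  split=> //; rewrite -negb_and !subr_eq0.
  apply/negP => /andP[/eqP e2 /eqP e1]; apply: AP.
  by rewrite [A]surjective_pairing [P]surjective_pairing e1 e2.
by move=> X [[->|->]|->] /=; ring.
Qed.

(** For A on the circle, the circle equation at A + s (P - A) is quadratic in s with root 0; this is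
    the other root, which is 0 exactly at tangency. *)
Definition chord_param (F : realType) (O A P : plane F) : F :=
  - 2 * ((A.1 - O.1) * (P.1 - A.1) + (A.2 - O.2) * (P.2 - A.2)) / sqdist A P.

Lemma reversion_outE (F : realType) (O P A : plane F) (r : F) :
  0 < r -> ~ circle O r P -> circle O r A ->
  let t := chord_param O A P in
  reversion (circle O r) P A =
    (A.1 + t * (P.1 - A.1), A.2 + t * (P.2 - A.2)).
Proof.
move=> r0 KP KA t.
have AP : A <> P by move=> e; apply: KP; rewrite -e.
have N0 := sqdist_neq0 AP.
have tN : t * sqdist A P =
    - 2 * ((A.1 - O.1) * (P.1 - A.1) + (A.2 - O.2) * (P.2 - A.2)).
  by rewrite /t /chord_param mulfVK.
have onK (s : F) :
    (A.1 + s * (P.1 - A.1) - O.1) ^+ 2 + (A.2 + s * (P.2 - A.2) - O.2) ^+ 2 =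
    r ^+ 2 + s * (s - t) * sqdist A P.
  have -> : s * (s - t) * sqdist A P =
    s ^+ 2 * sqdist A P - s * (t * sqdist A P) by ring.
  by rewrite tN -KA /sqdist; ring.
have fixA : (A.1 + 0 * (P.1 - A.1), A.2 + 0 * (P.2 - A.2)) = A.
  by rewrite !mul0r !addr0 -surjective_pairing.
(* At tangency there is no second intersection, and [xget] returns its default [A], in agreement
   with the formula at [t = 0]. *)
have [t0|t0] := eqVneq t 0.
  rewrite t0 fixA /reversion memNset //.
  case: xgetP => // B _ [KB [/(collinear_param AP)[s eB] nB]].
  case: nB; move: KB; rewrite eB /circle /= onK t0 subr0 => KB.
  have /eqP : s * s * sqdist A P = 0 by lra.
  rewrite mulf_eq0 (negPf N0) orbF mulf_eq0 orbb => /eqP ->.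
  exact: fixA.
apply: reversionE => //.
- by exists O, r.
- by rewrite /circle /= onK subrr mulr0 mul0r addr0.
- exact: collinear_of_param.
- rewrite [RHS]surjective_pairing; clearbody t => -[e1 e2].
  case/negP: N0; apply/eqP.
  have /eqP := addrI _ (etrans e1 (esym (addr0 A.1))).
  have /eqP := addrI _ (etrans e2 (esym (addr0 A.2))).
  rewrite !mulf_eq0 (negPf t0) /= /sqdist => /eqP -> /eqP ->.
  by rewrite expr0n addr0.
Qed.

(** * Coordinates along and across the line *)

(** Scalar product with (-b, a), as [ncoord] is with (a, b). Without normalization no square root
    occurs, and the squared radius becomes [(a ^+ 2 + b ^+ 2) * r ^+ 2]. *)
Definition tcoord (F : realType) (a b : F) (O X : plane F) : F :=
  a * (X.2 - O.2) - b * (X.1 - O.1).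

Definition ncoord (F : realType) (a b : F) (O X : plane F) : F :=
  a * (X.1 - O.1) + b * (X.2 - O.2).

Lemma sqr_sum_gt0 (F : realType) (a b : F) :
  (a != 0) || (b != 0) -> 0 < a ^+ 2 + b ^+ 2.
Proof.
move=> ab; rewrite lt_neqAle addr_ge0 ?sqr_ge0 // andbT eq_sym.
by rewrite paddr_eq0 ?sqr_ge0 // !sqrf_eq0 negb_and.
Qed.

Lemma coord_inj (F : realType) (a b : F) (O X Y : plane F) :
  (a != 0) || (b != 0) -> tcoord a b O X = tcoord a b O Y ->
  ncoord a b O X = ncoord a b O Y -> X = Y.
Proof.
move=> /sqr_sum_gt0 /lt0r_neq0 N0.
case: X Y => [x1 x2] [y1 y2]; rewrite /tcoord /ncoord /= => et en.
congr pair; apply: (mulfI N0).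
- have := congr2 (fun u v => a * u - b * v) en et => e; lra.
- have := congr2 (fun u v => b * u + a * v) en et => e; lra.
Qed.

Lemma circle_coordE (F : realType) (a b r : F) (O X : plane F) :
  (a != 0) || (b != 0) ->
  circle O r X <->
  tcoord a b O X ^+ 2 + ncoord a b O X ^+ 2 = (a ^+ 2 + b ^+ 2) * r ^+ 2.
Proof.
move=> /sqr_sum_gt0 /lt0r_neq0 N0.
have -> : tcoord a b O X ^+ 2 + ncoord a b O X ^+ 2 =
  (a ^+ 2 + b ^+ 2) * ((X.1 - O.1) ^+ 2 + (X.2 - O.2) ^+ 2).
  by rewrite /tcoord /ncoord; ring.
by split=> [-> //|]; exact: mulfI.
Qed.

(** [chord_param] in these coordinates, with [x ^+ 2 + y ^+ 2] replaced by its value [k] on the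
    circle. *)
Definition chord_ratio (F : realType) (k h p x y : F) : F :=
  - 2 * (p * x + h * y - k) / ((p - x) ^+ 2 + (h - y) ^+ 2).

Lemma reversion_coord (F : realType) (a b r : F) (O P A : plane F) :
  (a != 0) || (b != 0) -> 0 < r -> ~ circle O r P -> circle O r A ->
  let x := tcoord a b O A in let y := ncoord a b O A in
  let p := tcoord a b O P in let h := ncoord a b O P in
  let t := chord_ratio ((a ^+ 2 + b ^+ 2) * r ^+ 2) h p x y in
  [/\ (p - x) ^+ 2 + (h - y) ^+ 2 != 0,
      tcoord a b O (reversion (circle O r) P A) = x + t * (p - x) &
      ncoord a b O (reversion (circle O r) P A) = y + t * (h - y)].
Proof.
move=> ab r0 KP KA x y p h t.
have N0 := lt0r_neq0 (sqr_sum_gt0 ab).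
have D0 : sqdist A P != 0.
  by apply: sqdist_neq0 => e; apply: KP; rewrite -e.
have eD : (p - x) ^+ 2 + (h - y) ^+ 2 = (a ^+ 2 + b ^+ 2) * sqdist A P.
  by rewrite /p /h /x /y /sqdist /tcoord /ncoord; ring.
have et : chord_param O A P = t.
  rewrite /t /chord_ratio /chord_param eD -KA.
  have -> : p * x + h * y - (a ^+ 2 + b ^+ 2) *
      ((A.1 - O.1) ^+ 2 + (A.2 - O.2) ^+ 2) = (a ^+ 2 + b ^+ 2) *
      ((A.1 - O.1) * (P.1 - A.1) + (A.2 - O.2) * (P.2 - A.2)).
    by rewrite /p /h /x /y /tcoord /ncoord; ring.
  by field; rewrite N0 D0.
rewrite eD reversion_outE // et mulf_neq0 //.
by split=> //; rewrite /x /y /p /h /tcoord /ncoord /=; ring.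
Qed.

(** A center on the circle makes the reversion constant; otherwise the chord is parallel to the line
    and keeps its height. *)
Lemma ncoord_reversion_on (F : realType) (a b r : F) (O P A : plane F) :
  (a != 0) || (b != 0) -> 0 < r -> circle O r A ->
  circle O r P \/ ncoord a b O A = ncoord a b O P ->
  ncoord a b O (reversion (circle O r) P A) = ncoord a b O P.
Proof.
move=> ab r0 KA; case: (pselect (circle O r P)) => [KP _|KP [//|e]].
  by rewrite /reversion mem_set.
by have [_ _ ->] := reversion_coord ab r0 KP KA; rewrite e subrr mulr0 addr0.
Qed.

(** At equal heights the chord ratio is [- 2 * x / (p - x)], so [p] cancels from the image: every
    center on the line acts alike. *)
Lemma tcoord_reversion_on (F : realType) (a b r : F) (O P A : plane F) :
  (a != 0) || (b != 0) -> 0 < r -> ~ circle O r P -> circle O r A ->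
  ncoord a b O A = ncoord a b O P ->
  tcoord a b O (reversion (circle O r) P A) = - tcoord a b O A.
Proof.
move=> ab r0 KP KA e; have [] := reversion_coord ab r0 KP KA.
rewrite /chord_ratio -(proj1 (circle_coordE r O A ab) KA) e subrr.
rewrite (expr0n F 2) /= addr0 sqrf_eq0 => n0 -> _.
by field.
Qed.

(** * The chart sending the line to infinity *)

Definition wcoord (F : realType) (h x y : F) : F := x / (y - h).

(** The polar form of [(x, y)] and the foot [(0, h)] of the center on the line,
    divided by the equation of the line; [Ecoord k h x y] is affine in
    [u := (y - h)^-1], namely [(h ^+ 2 - k) * u + h]. *)
Definition Ecoord (F : realType) (k h x y : F) : F := (h * y - k) / (y - h).

Lemma wEcoord_conic (F : realType) (k h x y : F) :
  x ^+ 2 + y ^+ 2 = k -> y != h ->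
  (h ^+ 2 - k) * wcoord h x y ^+ 2 + Ecoord k h x y ^+ 2 = k.
Proof.
move=> <-; rewrite -subr_eq0 => n0; rewrite /wcoord /Ecoord.
by field.
Qed.

Lemma wEcoord_inj (F : realType) (k h x y x' y' : F) : k != 0 ->
  x ^+ 2 + y ^+ 2 = k -> y != h -> x' ^+ 2 + y' ^+ 2 = k -> y' != h ->
  wcoord h x y = wcoord h x' y' -> Ecoord k h x y = Ecoord k h x' y' ->
  x = x' /\ y = y'.
Proof.
move=> k0 K1; rewrite -subr_eq0 => n K2; rewrite -subr_eq0 => n' ew eE.
have Eu (z : F) : z - h != 0 ->
    (h * z - k) / (z - h) = (h ^+ 2 - k) * (z - h)^-1 + h.
  by move=> nz; field.
have conic (s z : F) : s ^+ 2 + z ^+ 2 = k -> z - h != 0 ->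
    (s / (z - h)) ^+ 2 + (h ^+ 2 - k) * (z - h)^-1 ^+ 2 +
    2 * h * (z - h)^-1 + 1 = 0.
  by move=> <- nz; field.
have := conic _ _ K1 n; have := conic _ _ K2 n'.
move: eE ew; rewrite /Ecoord /wcoord !Eu // => /addIr eE ew.
rewrite ew.
set u := (y - h)^-1 in eE *; set u' := (y' - h)^-1 in eE * => c2 c1.
have q : (h ^+ 2 - k) * u ^+ 2 = (h ^+ 2 - k) * u' ^+ 2.
  by rewrite !expr2 mulrA eE mulrAC eE mulrA.
have hu : h * u = h * u' by lra.
(* [k * u = h * (h * u) - (h ^+ 2 - k) * u] also covers a tangent line, where [h ^+ 2 = k] and [E]
   is constant. *)
have eu : u = u'.
  by apply: (mulfI k0); have := congr1 ( *%R h) hu => hhu; lra.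
have ey : y = y' by apply: (addIr (- h)); exact: invr_inj.
by split=> //; move: ew; rewrite ey; apply: mulIf; rewrite invr_eq0.
Qed.

(** [p ^+ 2 + m] is the power of the center. The coefficients depend on the center alone and satisfy
    [g ^+ 2 + m * d ^+ 2 = 1], so the map is a reflection for [m * w ^+ 2 + E ^+ 2]. *)
Lemma wEcoord_chord (F : realType) (k h p x y : F) :
  x ^+ 2 + y ^+ 2 = k -> y != h -> p ^+ 2 + h ^+ 2 != k ->
  (p - x) ^+ 2 + (h - y) ^+ 2 != 0 ->
  let t := chord_ratio k h p x y in
  let x' := x + t * (p - x) in let y' := y + t * (h - y) in
  let m := h ^+ 2 - k in
  let g := (m - p ^+ 2) / (p ^+ 2 + m) in let d := - 2 * p / (p ^+ 2 + m) in
  [/\ y' != h,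
      wcoord h x' y' = g * wcoord h x y + d * Ecoord k h x y &
      Ecoord k h x' y' = m * d * wcoord h x y - g * Ecoord k h x y].
Proof.
move=> <- {k}; rewrite -subr_eq0 => n; rewrite -subr_eq0 => D0 e0 t x' y' m g d.
have D1 : p ^+ 2 + m != 0 by rewrite /m addrA.
(* The factor [1 - t] is the power of the center over its squared distance to the point, hence
   nonzero. *)
have ey : y' - h = (y - h) * (p ^+ 2 + m) / ((p - x) ^+ 2 + (h - y) ^+ 2).
  by rewrite /y' /t /chord_ratio /m; field.
have n' : y' - h != 0 by rewrite ey !mulf_neq0 // invr_eq0.
split; first by rewrite -subr_eq0.
- rewrite /wcoord /Ecoord ey /x' /t /chord_ratio /g /d; rewrite /m in D1 *.
  by field; rewrite D1 n e0.
- rewrite /wcoord /Ecoord ey /y' /t /chord_ratio /g /d; rewrite /m in D1 *.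
  by field; rewrite D1 n e0.
Qed.

(** * Reflections and rotations of a binary quadratic form *)

Definition reflects (F : realType) (T : Type) (m : F) (C : set T)
    (w E : T -> F) (f : T -> T) : Prop :=
  exists g d, forall A, C A -> [/\ C (f A), w (f A) = g * w A + d * E A &
    E (f A) = m * d * w A - g * E A].

(** The matrix is g + d J with J = [[0, 1], [-m, 0]] and J^2 = -m; that of [reflects] is diag(1, -1)
    (g + d J). *)
Definition rotates (F : realType) (T : Type) (m : F) (C : set T)
    (w E : T -> F) (f : T -> T) : Prop :=
  exists g d, forall A, C A -> [/\ C (f A), w (f A) = g * w A + d * E A &
    E (f A) = g * E A - m * d * w A].

(** Conjugation by diag(1, -1) turns J into -J, so the product is (g' - d' J) (g + d J). *)
Lemma reflects_comp (F : realType) (T : Type) (m : F) (C : set T)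
    (w E : T -> F) (f f' : T -> T) :
  reflects m C w E f' -> reflects m C w E f -> rotates m C w E (f' \o f).
Proof.
move=> [g' [d' H']] [g [d H]]; exists (g' * g + m * d' * d), (g' * d - d' * g).
move=> A /H[CA ew eE]; have [CfA ew' eE'] := H' _ CA.
by split=> //=; rewrite ?ew' ?eE' ew eE; ring.
Qed.

Lemma rotates_comp (F : realType) (T : Type) (m : F) (C : set T)
    (w E : T -> F) (f f' : T -> T) :
  rotates m C w E f' -> rotates m C w E f -> rotates m C w E (f' \o f).
Proof.
move=> [g' [d' H']] [g [d H]]; exists (g' * g - m * d' * d), (g' * d + d' * g).
move=> A /H[CA ew eE]; have [CfA ew' eE'] := H' _ CA.
by split=> //=; rewrite ?ew' ?eE' ew eE; ring.
Qed.

(** For v = (w, E) the determinant of v and J v is [- (m * w ^+ 2 + E ^+ 2)]; when it is nonzero, (g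
    - 1) v + d J v = 0 forces [g = 1] and [d = 0]. *)
Lemma rotates_fixed_point (F : realType) (T : Type) (m : F) (C : set T)
    (w E : T -> F) (f : T -> T) (A B : T) :
  rotates m C w E f -> C A -> f A = A -> m * w A ^+ 2 + E A ^+ 2 != 0 ->
  C B -> [/\ C (f B), w (f B) = w B & E (f B) = E B].
Proof.
move=> [g [d H]] CA fA n0 CB.
have [_] := H A CA; rewrite fA => ew eE.
have g1 : g = 1.
  apply: (mulIf n0); rewrite mul1r.
  have := congr2 (fun u v => m * w A * u + E A * v) ew eE => /= e.
  lra.
have d0 : d = 0.
  apply: (mulIf n0); rewrite mul0r.
  have := congr2 (fun u v => E A * u - w A * v) ew eE => /= e.
  lra.
have [CfB -> ->] := H B CB; split=> //; rewrite g1 d0; ring.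
Qed.

(** * Reversions as reflections, and the product of four *)

Lemma reversion_reflects (F : realType) (a b r : F) (O P : plane F) :
  (a != 0) || (b != 0) -> 0 < r -> ~ circle O r P ->
  let k := (a ^+ 2 + b ^+ 2) * r ^+ 2 in let h := ncoord a b O P in
  let x := tcoord a b O in let y := ncoord a b O in
  reflects (h ^+ 2 - k) [set A | circle O r A /\ y A != h]
    (fun A => wcoord h (x A) (y A)) (fun A => Ecoord k h (x A) (y A))
    (reversion (circle O r) P).
Proof.
move=> ab r0 KP k h x y.
exists ((h ^+ 2 - k - x P ^+ 2) / (x P ^+ 2 + (h ^+ 2 - k))),
  (- 2 * x P / (x P ^+ 2 + (h ^+ 2 - k))) => A [KA nA].
have [e0 ex ey] := reversion_coord ab r0 KP KA.
have KA' := proj1 (circle_coordE r O A ab) KA.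
have nP : x P ^+ 2 + h ^+ 2 != k.
  by apply/eqP => e; apply: KP; exact/(circle_coordE r O P ab).
have [n' ew eE] := wEcoord_chord KA' nA nP e0.
rewrite /x /y /= ex ey; split=> //; split=> //.
exact: reversion_in.
Qed.

Theorem theorem2p2 (F : realType) (K L : set (plane F)) (P Q R S : plane F)
  (hK : is_circle K) (hL : is_line L)
  (hP : L P) (hQ : L Q) (hR : L R) (hS : L S) :
  let Z := reversion K S \o reversion K R \o reversion K Q \o reversion K P in
  (exists X : plane F, K X /\ ~ L X /\ Z X = X) ->
  forall X : plane F, K X -> Z X = X.
Proof.
case: hK => O [r [r0 ->]] {K}; case: hL hP hQ hR hS => a [b [c [ab ->]]] {L}.
pose y := ncoord a b O; pose h := c - a * O.1 - b * O.2.
have yL (X : plane F) : (a * X.1 + b * X.2 = c) <-> y X = h.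
  by rewrite /y /h /ncoord; split=> e; lra.
move=> /yL hP /yL hQ /yL hR /yL hS.
set K := circle O r => Z [X [KX [/yL/eqP nX ZX]]].
have inK (C A : plane F) : K A -> K (reversion K C A) by exact: reversion_in.
have onL (C A : plane F) : y C = h -> K A -> K C \/ y A = h ->
    y (reversion K C A) = h.
  by move=> eC KA H; rewrite -[RHS]eC; apply: ncoord_reversion_on => //;
    rewrite -/y eC.
(* A center on the circle would send everything to itself, a point of the line; the later reversions
   stay on the line, contradicting that X is off it. *)
have KS : ~ K S.
  move=> KC; case/eqP: nX; rewrite -ZX /Z /=.
  by apply: (onL S) => //; [do 3 apply/inK|left].
have KR : ~ K R.
  move=> KC; case/eqP: nX; rewrite -ZX /Z /=.
  apply: (onL S) => //; [by do 3 apply/inK|right].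
  by apply: (onL R) => //; [do 2 apply/inK|left].
have KQ : ~ K Q.
  move=> KC; case/eqP: nX; rewrite -ZX /Z /=.
  apply: (onL S) => //; [by do 3 apply/inK|right].
  apply: (onL R) => //; [by do 2 apply/inK|right].
  by apply: (onL Q) => //; [apply/inK|left].
have KP : ~ K P.
  move=> KC; case/eqP: nX; rewrite -ZX /Z /=.
  apply: (onL S) => //; [by do 3 apply/inK|right].
  apply: (onL R) => //; [by do 2 apply/inK|right].
  apply: (onL Q) => //; [by apply/inK|right].
  by apply: (onL P) => //; left.
move=> Y KY; have [eY|nY] := eqVneq (y Y) h.
  (* On the line each factor negates [tcoord], and four sign changes cancel. *)
  have swap (C A : plane F) : y C = h -> ~ K C -> K A /\ y A = h ->
      [/\ K (reversion K C A), y (reversion K C A) = h &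
          tcoord a b O (reversion K C A) = - tcoord a b O A].
    move=> eC KC [KA eA]; split; [exact: inK|by apply: onL => //; right|].
    by apply: tcoord_reversion_on => //; rewrite -/y eA eC.
  have [K1 y1 x1] := swap _ _ hP KP (conj KY eY).
  have [K2 y2 x2] := swap _ _ hQ KQ (conj K1 y1).
  have [K3 y3 x3] := swap _ _ hR KR (conj K2 y2).
  have [_ y4 x4] := swap _ _ hS KS (conj K3 y3).
  apply: (coord_inj (O := O) ab); last by rewrite -/y y4 eY.
  by rewrite x4 x3 x2 x1 !opprK.
pose k := (a ^+ 2 + b ^+ 2) * r ^+ 2.
have k0 : k != 0 by rewrite mulf_neq0 ?lt0r_neq0 ?exprn_gt0 ?sqr_sum_gt0.
have refl (C : plane F) : y C = h -> ~ K C ->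
    reflects (h ^+ 2 - k) [set A | K A /\ y A != h]
      (fun A => wcoord h (tcoord a b O A) (y A))
      (fun A => Ecoord k h (tcoord a b O A) (y A)) (reversion K C).
  by move=> <- KC; exact: reversion_reflects.
(* The factors are paired as two rotations; this bracketing is convertible to [Z]. *)
have rotZ := rotates_comp
  (reflects_comp (refl S hS KS) (refl R hR KR))
  (reflects_comp (refl Q hQ KQ) (refl P hP KP)).
have Kcoord (A : plane F) : K A -> tcoord a b O A ^+ 2 + y A ^+ 2 = k.
  by move/(circle_coordE r O A ab).
have fixZ := rotates_fixed_point rotZ (conj KX nX) ZX.
(* The conic equation at X turns the nondegeneracy condition into [k != 0]. *)
have := fixZ Y; rewrite wEcoord_conic ?Kcoord // => /(_ k0 (conj KY nY)).
move=> [[KZY nZY] ew eE].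
have [ex ey] := wEcoord_inj k0 (Kcoord _ KZY) nZY (Kcoord _ KY) nY ew eE.
exact: (coord_inj ab ex ey).
Qed.
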